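(* For every $p\in(0,1)$, \[ \gamma_\infty^*(p)\le\min\Big\{p^{p/(1-p)},\ \frac1\beta\Big\}, \] where $\beta$ is the unique solution of $\int_0^1\big(y(1-\log y)+\beta-1\big)^{-1}\,dy=1$ (so $1/\beta\approx0.745$).
   Context: For $p\in(0,1]$, $\gamma_\infty^*(p)$ is the optimal value of the continuous linear program $(CLP)_p$: maximize $\gamma$ over $\gamma\ge0$ and measurable $\alpha:[0,1]\times\{1,2,\dots\}\to[0,1]$ subject to \[ t\,\alpha(t,s)\le 1-p\int_0^t\sum_{\sigma\ge1}\alpha(\tau,\sigma)\,d\tau\quad\forall t\in[0,1],\ s\ge1, \] \[ \gamma\le\frac{p}{1-(1-p)^k}\int_0^1\sum_{s\ge1}\alpha(t,s)\sum_{\ell=s}^{k}\binom{\ell-1}{s-1}t^s(1-t)^{\ell-s}\,dt\quad\forall k\ge1. \] (By the paper's results, $\gamma_\infty^*(p)=\lim_{n\to\infty}\gamma_n^*(p)$, the limit of the optimal robust ratios of the secretary problem with uncertain acceptance with $n$ candidates and acceptance probability $p$.) *)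

(* Defs.v *)
From HB Require Import structures.
From mathcomp Require Import all_boot all_order all_algebra.
From mathcomp Require Import all_classical all_reals all_analysis.
Set Implicit Arguments. Unset Strict Implicit. Unset Printing Implicit Defensive.
Import Order.TTheory GRing.Theory Num.Theory.
Local Open Scope classical_set_scope.
Local Open Scope ring_scope.

Section CLP.
Variable R : realType.
Let mu := @lebesgue_measure R.

(* alpha t s : the variable alpha(t,s); only s >= 1 is relevant. *)

Definition clp_mass (alpha : R -> nat -> R) (t : R) : \bar R :=
  (\int[mu]_(tau in `[0%R, t]) (\sum_(1 <= sigma <oo) (alpha tau sigma)%:E))%E.

(* integral_0^1 sum_{s>=1} alpha(t,s) sum_{l=s}^k C(l-1,s-1) t^s (1-t)^(l-s) dt
   (terms with s > k vanish since the inner sum is empty) *)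
Definition clp_value (alpha : R -> nat -> R) (k : nat) : \bar R :=
  (\int[mu]_(t in `[0%R, 1%R])
     (\sum_(1 <= s < k.+1) alpha t s *
        \sum_(s <= l < k.+1) ('C(l.-1, s.-1))%:R * t ^+ s * (1 - t) ^+ (l - s))%:E)%E.

Definition clp_feasible (p gamma : R) (alpha : R -> nat -> R) : Prop :=
  [/\ 0 <= gamma,
      (forall s, measurable_fun (`[0%R, 1%R] : set R) (fun t : R => alpha t s)),
      (forall t s, 0 <= t <= 1 -> 0 <= alpha t s <= 1),
      (forall t s, 0 <= t <= 1 -> (1 <= s)%N ->
         ((t * alpha t s)%:E <= 1%:E - p%:E * clp_mass alpha t)%E) &
      (forall k, (1 <= k)%N ->
         (gamma%:E <= (p / (1 - (1 - p) ^+ k))%:E * clp_value alpha k)%E)].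

Definition gamma_infty_star (p : R) : \bar R :=
  ereal_sup [set gamma%:E | gamma in [set g | exists alpha, clp_feasible p g alpha]].

Definition beta_eq (beta : R) : Prop :=
  (\int[mu]_(y in `[0%R, 1%R]) ((y * (1 - ln y) + beta - 1)^-1)%:E = 1%:E)%E.

End CLP.

(* Main.v *)
Require Import Defs.
From HB Require Import structures.
From mathcomp Require Import all_boot all_order all_algebra.
From mathcomp Require Import all_classical all_reals all_analysis.
From mathcomp Require Import measurable_realfun ring lra.
Import Order.TTheory GRing.Theory Num.Theory.
Import numFieldNormedType.Exports.
Local Open Scope classical_set_scope.
Local Open Scope ring_scope.

Set Implicit Arguments.
Unset Strict Implicit.
Unset Printing Implicit Defensive.

(** Let H(t) be p times the total acceptance mass up to t.

    For the first bound only the constraint k = 1 is used: it is Smith's secretary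
    problem, and the optimal continuation value Q solves t Q' = p Q - t, so that
    t |-> int_0^t x alpha(x,1) dx + Q(t) (1 - H(t)) is nonincreasing on [w, 1], where
    w = p^(1/(1-p)) is the optimal threshold.

    For the second bound, split the k-th integral at a time T. Before T the negative
    binomial weights are at most 1; after T use t alpha(t,s) <= 1 - H(t) and the fact
    that the weights t^(s-1) (1-t)^(l-s) C(l-1,s-1) sum to k. This gives
      gamma (1 - (1-p)^k) <= H(T) + p k int_T^1 (1 - H)   for all k >= 0,
    and averaging k over a Poisson law of parameter - ln y / p,
      gamma (1 - y) <= H(T) - ln y int_T^1 (1 - H)   for all 0 < y <= 1.
    Now let D(y) = y (1 - ln y) + beta - 1 (the Hill-Kertz denominator [hk_den]) and take T = T(y) = int_y^1 1/D, so that
    T(0) = 1 by the choice of beta. With b(y) = int_(T(y))^1 (1 - H), the last inequality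
    reads ((b - gamma y) / D)' <= (1 - gamma beta) / D^2. As (b - gamma y) / D vanishes at
    0 and is nonnegative at 1, gamma beta <= 1.

    H is not known to be differentiable, so both descents are carried out on increments,
    up to an error quadratic in the step. *)

(** * Integrals over compact intervals, and monotonicity up to quadratic errors *)

Section itv_integral.
Variable R : realType.
Let mu := @lebesgue_measure R.
Implicit Types (f : R -> R) (a b c : R).

Lemma itv_integrableS f a b c d : a <= b -> c <= d ->
  mu.-integrable `[a, d] (EFin \o f) -> mu.-integrable `[b, c] (EFin \o f).
Proof.
move=> ab cd; apply: integrableS => //.
by apply: subset_itv; rewrite bnd_simp.
Qed.

Lemma Rintegral_itv_split f a b c : a <= b -> b <= c ->
  mu.-integrable `[a, c] (EFin \o f) ->
  \int[mu]_(x in `[a, c]) f x =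
  \int[mu]_(x in `[a, b]) f x + \int[mu]_(x in `[b, c]) f x.
Proof.
move=> ab bc fi.
have := @Rintegral_itvB R f (BLeft a) (BRight c) b fi.
rewrite !bnd_simp => /(_ ab bc) /(canRL (subrK _)) ->.
rewrite addrC Rintegral_itv_obnd_cbnd//.
apply: (@integrableS _ _ _ mu `[a, c]) => //.
by apply: subset_itv; rewrite bnd_simp.
Qed.

Lemma itv_measure_lty a b : (mu `[a, b] < +oo)%E.
Proof.
by rewrite /mu lebesgue_measure_itv/=; case: ifP => // _; rewrite ltry.
Qed.

Lemma integrable_itv_cst a b (k : R) : mu.-integrable `[a, b] (EFin \o cst k).
Proof.
apply: measurable_bounded_integrable => //; first exact: itv_measure_lty.
exists `|k|; split; first exact: num_real.
by move=> x kx y _ /=; exact: ltW.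
Qed.

Lemma Rintegral_itv_cst a b (k : R) : a <= b ->
  \int[mu]_(x in `[a, b]) k = k * (b - a).
Proof.
move=> ab; suff -> : \int[mu]_(x in `[a, b]) k = k * fine (mu `[a, b]).
  congr (_ * _); rewrite /mu lebesgue_measure_itv/=.
  by case: ifPn; rewrite lte_fin//= -leNgt => ba; apply/esym/eqP; rewrite subr_eq0 eq_le ba.
exact: Rintegral_cst.
Qed.

Lemma Rintegral_itv_le f a b (k : R) : a <= b ->
  mu.-integrable `[a, b] (EFin \o f) ->
  (forall x, a <= x <= b -> f x <= k) ->
  \int[mu]_(x in `[a, b]) f x <= k * (b - a).
Proof.
move=> ab fi fk; rewrite -Rintegral_itv_cst//.
by apply: le_Rintegral => //; exact: integrable_itv_cst.
Qed.

Lemma Rintegral_itv_ge f a b (k : R) : a <= b ->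
  mu.-integrable `[a, b] (EFin \o f) ->
  (forall x, a <= x <= b -> k <= f x) ->
  k * (b - a) <= \int[mu]_(x in `[a, b]) f x.
Proof.
move=> ab fi fk; rewrite -Rintegral_itv_cst//.
by apply: le_Rintegral => //; exact: integrable_itv_cst.
Qed.

Lemma bounded_itv_integrable f a b (m M : R) :
  measurable_fun (`[a, b] : set R) f ->
  (forall x, a <= x <= b -> m <= f x <= M) ->
  mu.-integrable `[a, b] (EFin \o f).
Proof.
move=> mf fM; apply: measurable_bounded_integrable => //.
- exact: itv_measure_lty.
- exists (`|m| + `|M|); split; first exact: num_real.
  move=> x kx y /=; rewrite in_itv/= => /fM/andP[my yM].
  apply: (le_trans _ (ltW kx)); rewrite ler_norml; apply/andP; split.
    by apply: le_trans my; rewrite lerNl; have := ler_norm (- m);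
       rewrite normrN => /le_trans; apply; rewrite lerDl.
  by apply: (le_trans yM); apply: (le_trans (ler_norm _)); rewrite lerDr.
Qed.

(* Subdividing [a, b] into n equal parts leaves a total error of order 1/n. *)
Lemma quadratic_error_nonincreasing f a b (K : R) : a <= b ->
  (forall x y, a <= x -> x <= y -> y <= b -> f y - f x <= K * (y - x) ^+ 2) ->
  f b <= f a.
Proof.
move=> ab hf; rewrite -subr_le0.
have step (n : nat) : f b - f a <= K * (b - a) ^+ 2 / n.+1%:R.
  have n0 : (n.+1%:R != 0 :> R) by rewrite pnatr_eq0.
  pose h := (b - a) / n.+1%:R.
  have h0 : 0 <= h by rewrite divr_ge0// subr_ge0.
  have bE : b = a + n.+1%:R * h by rewrite /h; field; rewrite addrC natr1.
  have k_le k : (k <= n.+1)%N -> f (a + k%:R * h) - f a <= k%:R * (K * h ^+ 2).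
    elim: k => [_|k IH kn]; first by rewrite !mul0r addr0 subrr.
    have e : k.+1%:R = k%:R + 1 :> R by rewrite natr1.
    have kn' : (k%:R + 1) * h <= n.+1%:R * h by rewrite -e ler_wpM2r// ler_nat.
    have kh : 0 <= k%:R * h by rewrite mulr_ge0.
    have := hf (a + k%:R * h) (a + (k%:R + 1) * h).
    have -> : a + (k%:R + 1) * h - (a + k%:R * h) = h by ring.
    move=> /(_ ltac:(lra) ltac:(lra) ltac:(lra)).
    by rewrite e; have := IH (ltnW kn); lra.
  have := k_le n.+1 (leqnn _); rewrite -bE => /le_trans; apply.
  by rewrite /h le_eqVlt; apply/orP; left; apply/eqP; field; rewrite addrC natr1.
rewrite leNgt; apply/negP => fab.
have C0 : 0 < `|K * (b - a) ^+ 2| + 1 by rewrite ltr_wpDl.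
have e0 : 0 < (f b - f a) / (`|K * (b - a) ^+ 2| + 1) by rewrite divr_gt0.
have [n _ /(_ n (leqnn n)) /=] := near_infty_natSinv_lt (PosNum e0).
rewrite ltr_pdivlMr// mulrC => hn.
have := step n; rewrite leNgt => /negP; apply; apply: le_lt_trans hn.
rewrite ler_wpM2r ?invr_ge0//.
by apply: (le_trans (ler_norm _)); rewrite lerDl.
Qed.

End itv_integral.

(** * The bound p^(p/(1-p)), by Smith's secretary problem *)

Section power_bound.
Variable R : realType.
Let mu := @lebesgue_measure R.

(** Bernoulli's inequality: divided by exp (p L), with L = ln x, the right side is p exp ((1 - p) L)
    + (1 - p) exp (- p L), and exp u >= 1 + u makes this at least 1. *)
Lemma powR_le_affine (x p : R) : 0 < x -> 0 <= p <= 1 ->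
  x `^ p <= 1 + p * (x - 1).
Proof.
move=> x0 /andP[p0 p1]; rewrite /powR gt_eqF//; set L := ln x.
have m0 : 0 < expR (p * L) by exact: expR_gt0.
have h1 : 1 + (1 - p) * L <= x / expR (p * L).
  by rewrite -[X in _ <= X / _](lnK x0) -/L -expRB (_ : L - p * L = (1 - p) * L) ?expR_ge1Dx//; ring.
have h2 : 1 - p * L <= (expR (p * L))^-1 by rewrite -expRN expR_ge1Dx.
rewrite -[leLHS]mul1r -ler_pdivlMr//.
have -> : (1 + p * (x - 1)) / expR (p * L) =
   p * (x / expR (p * L)) + (1 - p) * (expR (p * L))^-1 by ring.
have := ler_wpM2l p0 h1; have := ler_wpM2l (_ : 0 <= 1 - p) h2.
by rewrite subr_ge0 => /(_ p1); lra.
Qed.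

Lemma powR_le_tangent (x y p : R) : 0 < x -> 0 < y -> 0 <= p <= 1 ->
  y `^ p <= x `^ p + p * (x `^ p / x) * (y - x).
Proof.
move=> x0 y0 p01; have := @powR_le_affine (y / x) p (divr_gt0 y0 x0) p01.
have xp0 : 0 < x `^ p by exact: powR_gt0.
have -> : y `^ p = x `^ p * (y / x) `^ p.
  by rewrite -powRM ?(ltW x0) ?divr_ge0 ?(ltW x0) ?(ltW y0)// mulrC divfK ?gt_eqF.
move=> /(ler_wpM2l (ltW xp0)) /le_trans; apply.
by rewrite le_eqVlt; apply/orP; left; apply/eqP; field; rewrite gt_eqF.
Qed.

(** [f] stands for alpha(., 1) and [H] for the mass H(t) of all ranks. The growth of [H] is only
    bounded below, because ranks s > 1 add to it. *)
Lemma best_only_bound (p gamma : R) (H f : R -> R) : 0 < p < 1 ->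
  measurable_fun (`[0, 1] : set R) f ->
  (forall t, 0 <= t <= 1 -> 0 <= f t <= 1) ->
  0 <= H 0 ->
  (forall t, 0 <= t <= 1 -> t * f t <= 1 - H t) ->
  (forall a b, 0 <= a -> a <= b -> b <= 1 ->
    p * \int[mu]_(t in `[a, b]) f t <= H b - H a) ->
  gamma <= \int[mu]_(t in `[0, 1]) (t * f t) ->
  gamma <= p `^ (p / (1 - p)).
Proof.
move=> /andP[p0 p1] mf f01 H0 tfH pfH gle.
have p1' : 0 < 1 - p by rewrite subr_gt0.
have p01 : 0 <= p <= 1 by rewrite !ltW.
pose w := p `^ (1 / (1 - p)).
have w0 : 0 < w by exact: powR_gt0.
have w1 : w <= 1.
  rewrite -[leRHS](powRr0 p); apply: ger_powR; first by rewrite p0 ltW.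
  by rewrite divr_ge0// ltW.
have wE : p `^ (p / (1 - p)) = w / p.
  rewrite /w -(@mulr_powRB1 _ p (1 / (1 - p)))// ?ltW ?divr_gt0//.
  rewrite (_ : 1 / (1 - p) - 1 = p / (1 - p)); last by field; rewrite gt_eqF.
  by rewrite [RHS]mulrC mulKf// gt_eqF.
have wp1 : w `^ (1 - p) = p.
  by rewrite /w -powRrM div1r mulVf ?gt_eqF// powRr1// ltW.
have tp t : 0 < t -> t `^ p / t = (t `^ (1 - p))^-1.
  move=> t0; rewrite -powRN -(@mulr_powRB1 _ t p)// ?ltW//.
  by rewrite (_ : - (1 - p) = p - 1) 1?mulrC ?mulKf ?gt_eqF//; ring.
(* [Q] solves t Q' = p Q - t with Q(1) = 0, and [q] is - Q'. Since w^(1-p) = p, [q] is nonnegative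
   from [w] on. *)
pose Q t := (t `^ p - t) / (1 - p).
pose q t := 1 - p * Q t / t.
have qE t : 0 < t -> q t = (1 - p * (t `^ p / t)) / (1 - p).
  by move=> t0; rewrite /q /Q; field; rewrite !gt_eqF.
have q0 t : w <= t -> 0 <= q t.
  move=> wt; have t0 : 0 < t by exact: lt_le_trans wt.
  rewrite qE// divr_ge0 ?(ltW p1')// subr_ge0 tp//.
  rewrite ler_pdivrMr ?powR_gt0// mul1r -[leLHS]wp1.
  by apply: ge0_ler_powR => //; rewrite ?nnegrE ltW.
have Q0 t : 0 < t -> t <= 1 -> 0 <= Q t.
  move=> t0 t1; rewrite divr_ge0 ?(ltW p1')// subr_ge0.
  by apply: ger1_powR; rewrite ?t0// ltW.
have Qt t s : 0 < t -> 0 < s -> Q s <= Q t - q t * (s - t).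
  move=> t0 s0; have := powR_le_tangent t0 s0 p01; rewrite qE// /Q => h.
  rewrite -subr_ge0.
  rewrite (_ : _ - _ = (t `^ p + p * (t `^ p / t) * (s - t) - s `^ p) / (1 - p)).
    by rewrite divr_ge0 ?(ltW p1')// subr_ge0.
  by field; rewrite !gt_eqF.
have Qw : Q w = w / p.
  have -> : Q w = (w `^ p / w - 1) * w / (1 - p) by rewrite /Q; field; rewrite !gt_eqF.
  by rewrite tp// wp1; field; rewrite !gt_eqF.
have fi a b : 0 <= a -> b <= 1 -> mu.-integrable `[a, b] (EFin \o f).
  move=> a0 b1; apply: (@itv_integrableS _ _ 0 _ _ 1) => //.
  by apply: bounded_itv_integrable => //; exact: f01.
have gi a b : 0 <= a -> b <= 1 -> mu.-integrable `[a, b] (EFin \o (fun t => t * f t)).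
  move=> a0 b1; apply: (@itv_integrableS _ _ 0 _ _ 1) => //.
  apply: (@bounded_itv_integrable _ _ _ _ 0 1) => //.
    by apply: measurable_funM => //; exact: measurable_id.
  move=> t t01; have /andP[ft0 ft1] := f01 _ t01; case/andP: t01 => t0 t1.
  by rewrite mulr_ge0//= mulr_ile1.
have Hnd a b : 0 <= a -> a <= b -> b <= 1 -> H a <= H b.
  move=> a0 ab b1; rewrite -subr_ge0; apply: le_trans (pfH _ _ a0 ab b1).
  rewrite mulr_ge0 ?(ltW p0)//; apply: Rintegral_ge0 => t /=.
  rewrite in_itv/= => /andP[at_ tb].
  by have /andP[] : 0 <= f t <= 1 by apply: f01; lra.
pose G t := \int[mu]_(x in `[0, t]) (x * f x).
pose Z t := G t + Q t * (1 - H t).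
(* With x the integral of [f] over [t, s], the increment of [Z] is at most (s - p Q s) x - q t (1 -
   H t) (s - t). As t x <= (1 - H t) (s - t) and t q t = t - p Q t, at most 2 (s - t) x remains: one
   s - t for replacing s by t, one for replacing Q s by Q t. *)
have Zle : Z 1 <= Z w.
  apply: (@quadratic_error_nonincreasing _ Z w 1 2) => // t s wt ts s1.
  have t0 : 0 < t by exact: lt_le_trans wt.
  have s0 : 0 < s by exact: lt_le_trans ts.
  rewrite /Z {1}/G (@Rintegral_itv_split _ _ 0 t s) ?gi ?(ltW t0)// -/(G t).
  set g := \int[mu]_(u in `[t, s]) (u * f u).
  set x := \int[mu]_(u in `[t, s]) f u.
  have xH : p * x <= H s - H t by apply: pfH => //; exact: ltW.
  have x0 : 0 <= x.
    apply: Rintegral_ge0 => u /=; rewrite in_itv/= => /andP[tu us].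
    by have /andP[] : 0 <= f u <= 1 by apply: f01; lra.
  have xd : x <= s - t.
    rewrite -[leRHS]mul1r; apply: Rintegral_itv_le; rewrite ?fi ?(ltW t0)//.
    move=> u /andP[tu us].
    by have /andP[] : 0 <= f u <= 1 by apply: f01; lra.
  have ts_int : mu.-integrable `[t, s] (EFin \o f) by rewrite fi ?(ltW t0).
  have gx : g <= s * x.
    rewrite -RintegralZl//; apply: le_Rintegral => //.
    - by rewrite gi ?(ltW t0).
    - exact: (integrableZl _ s ts_int).
    - move=> u /=; rewrite in_itv/= => /andP[tu us].
      rewrite ler_wpM2r//.
      by have /andP[] : 0 <= f u <= 1 by apply: f01; lra.
  have xg : t * x <= g.
    rewrite -RintegralZl//; apply: le_Rintegral => //.
    - exact: (integrableZl _ t ts_int).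
    - by rewrite gi ?(ltW t0).
    - move=> u /=; rewrite in_itv/= => /andP[tu us].
      rewrite ler_wpM2r//.
      by have /andP[] : 0 <= f u <= 1 by apply: f01; lra.
  have gd : g <= (1 - H t) * (s - t).
    apply: Rintegral_itv_le; rewrite ?gi ?(ltW t0)// => u /andP[tu us].
    apply: le_trans (tfH u _) _; first by lra.
    by rewrite lerD2l lerN2; apply: Hnd; lra.
  have Qs0 : 0 <= Q s by exact: Q0.
  have h1 : Q s <= Q t - q t * (s - t) by exact: Qt.
  have qs1 : q s <= 1 by rewrite /q gerBl divr_ge0 ?(ltW s0)// mulr_ge0// ltW.
  have h2 : Q t <= Q s + (s - t).
    have := Qt s t s0 t0 => /le_trans; apply.
    by have : 0 <= (1 - q s) * (s - t); [rewrite mulr_ge0 ?subr_ge0 |]; lra.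
  have qt0 := q0 _ wt.
  have tq : t * q t = t - p * Q t by rewrite /q; field; rewrite gt_eqF.
  have e0 : 0 <= 1 - H t.
    have /andP[ft0 _] : 0 <= f t <= 1 by apply: f01; lra.
    by apply: le_trans (tfH t _); [rewrite mulr_ge0// ltW|lra].
  have k1 : Q s * (p * x) <= Q s * (H s - H t) by exact: ler_wpM2l.
  have k2 : (s - p * Q s) * x <= (t * q t + 2 * (s - t)) * x.
    apply: ler_wpM2r => //; rewrite tq.
    have : p * Q t <= p * (Q s + (s - t)) by rewrite ler_wpM2l// ltW.
    have : p * (s - t) <= 1 * (s - t) by rewrite ler_wpM2r ?subr_ge0// ltW.
    by lra.
  have k3 : q t * (t * x) <= q t * ((1 - H t) * (s - t)).
    by rewrite ler_wpM2l//; exact: le_trans gd.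
  have k4 : (1 - H t) * Q s <= (1 - H t) * (Q t - q t * (s - t)) by exact: ler_wpM2l.
  have k5 : (s - t) * x <= (s - t) * (s - t) by rewrite ler_wpM2l ?subr_ge0.
  by nra.
rewrite wE -Qw; apply: (le_trans gle).
have Q1 : Q 1 = 0 by rewrite /Q powR1 subrr mul0r.
have -> : \int[mu]_(t in `[0, 1]) (t * f t) = Z 1 by rewrite /Z Q1 mul0r addr0.
apply: (le_trans Zle); rewrite /Z mulrBr mulr1.
(* Before [w] a unit of mass of [f] earns at most w = p Q w and raises [H] by at least p, so Z w <=
   Q w. *)
suff : G w <= Q w * H w by lra.
have Gw : G w <= w * \int[mu]_(t in `[0, w]) f t.
  rewrite -RintegralZl//; last exact: fi.
  apply: le_Rintegral => //; first exact: gi.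
  - exact: (integrableZl _ w (fi _ _ _ _)).
  - move=> u /=; rewrite in_itv/= => /andP[tu us].
    rewrite ler_wpM2r//.
    by have /andP[] : 0 <= f u <= 1 by apply: f01; lra.
have := pfH 0 w (lexx _) (ltW w0) w1.
rewrite mulrC -ler_pdivlMr// => fw; apply: (le_trans Gw).
rewrite Qw -mulrA ler_wpM2l ?(ltW w0)//; apply: (le_trans fw).
by rewrite mulrC ler_wpM2l ?invr_ge0 ?(ltW p0)//; lra.
Qed.
End power_bound.

(** * The bound 1/beta, by the descent of a potential *)

Section prophet_bound.
Variable R : realType.
Let mu := @lebesgue_measure R.

Definition hk_den (beta y : R) := y * (1 - ln y) + beta - 1.

Lemma ln_ge_1BV (x : R) : 0 < x -> 1 - x^-1 <= ln x.
Proof.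
move=> x0; have := @le_ln1Dx R (x^-1 - 1).
rewrite subrKC lnV// => h; have : -1 < x^-1 - 1 by rewrite ltrBrDl subrr invr_gt0.
by move=> /h; lra.
Qed.

Lemma hk_den_ge (beta y : R) : 0 <= y <= 1 -> beta - 1 <= hk_den beta y.
Proof.
move=> /andP[y0 y1]; have := ln_le0 y1 => l0.
by rewrite /hk_den -addrA lerDr mulr_ge0// subr_ge0 (le_trans l0).
Qed.

Lemma hk_den_le (beta y : R) : 0 <= y <= 1 -> hk_den beta y <= beta.
Proof.
rewrite /hk_den => /andP[]; rewrite le_eqVlt => /predU1P[<- _|y0 y1].
  by rewrite mul0r; lra.
have := ler_wpM2l (ltW y0) (ln_ge_1BV y0).
by rewrite mulrBr divff ?gt_eqF//; lra.
Qed.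

(** D' = - ln y, so up to sign this is the Taylor remainder at [y], and D is concave. Both bounds
    come from 1 - 1/u <= ln u <= u - 1 at u = y / x. *)
Lemma hk_den_diff (beta x y : R) : 0 < x -> x <= y ->
  0 <= hk_den beta y - hk_den beta x + ln y * (y - x) <= (y - x) ^+ 2 / y.
Proof.
move=> x0 xy; have y0 : 0 < y by exact: lt_le_trans xy.
have -> : hk_den beta y - hk_den beta x + ln y * (y - x) =
    (y - x) - x * (ln y - ln x) by rewrite /hk_den; ring.
rewrite -ln_div//; apply/andP; split.
  have := @le_ln1Dx R (y / x - 1); rewrite subrKC => h.
  have : ln (y / x) <= y / x - 1 by apply: h; rewrite ltrBrDl subrr divr_gt0.
  by move=> /(ler_wpM2l (ltW x0)); rewrite mulrBr [x * (y / x)]mulrC divfK ?gt_eqF// mulr1; lra.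
have := ler_wpM2l (ltW x0) (ln_ge_1BV (divr_gt0 y0 x0)).
rewrite invf_div.
have -> : (y - x) ^+ 2 / y = (y - x) - x * (1 - x / y) by field; rewrite gt_eqF.
by lra.
Qed.

Lemma hk_den_le_homo (beta x y : R) : 0 < x -> x <= y -> y <= 1 ->
  hk_den beta x <= hk_den beta y.
Proof.
move=> x0 xy y1; have /andP[+ _] := hk_den_diff beta x0 xy.
have : 0 <= - ln y * (y - x) by rewrite mulr_ge0 ?subr_ge0// oppr_ge0 ln_le0.
by lra.
Qed.

Lemma measurable_hk_den (beta : R) : measurable_fun (setT : set R) (hk_den beta).
Proof.
apply: measurable_funB; last exact: measurable_cst.
apply: measurable_funD; last exact: measurable_cst.
apply: measurable_funM; first exact: measurable_id.
by apply: measurable_funB; [exact: measurable_cst|exact: measurable_ln].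
Qed.

Lemma hk_integrable (beta a b : R) : 1 < beta -> 0 <= a -> b <= 1 ->
  mu.-integrable `[a, b] (EFin \o (fun y => (hk_den beta y)^-1)).
Proof.
move=> b1 a0 b1'; apply: (@itv_integrableS _ _ 0 _ _ 1) => //.
apply: (@bounded_itv_integrable _ _ _ _ 0 (beta - 1)^-1) => //.
  (* Inversion agrees with the power of exponent -1 on nonnegative reals, which is measurable. *)
  apply: (@eq_measurable_fun _ _ _ _ _ (fun y => hk_den beta y `^ (-1))).
    move=> y; rewrite inE/= in_itv/= => /(hk_den_ge beta) h.
    by rewrite powR_inv1//; apply: le_trans h; rewrite subr_ge0 ltW.
  apply: measurable_funTS.
  apply: (measurableT_comp (measurable_powR _)); exact: measurable_hk_den.
move=> y /(hk_den_ge beta) h; have m0 : 0 < beta - 1 by rewrite subr_gt0.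
have D0 := lt_le_trans m0 h.
by rewrite invr_ge0 (ltW D0)/= lef_pV2// posrE.
Qed.

Lemma beta_eqE (beta : R) : 1 < beta ->
  beta_eq beta <-> \int[mu]_(y in `[0, 1]) (hk_den beta y)^-1 = 1.
Proof.
move=> b1; rewrite /beta_eq /Rintegral.
have fin : (\int[mu]_(y in `[0%R, 1%R]) ((hk_den beta y)^-1)%:E)%E \is a fin_num.
  exact: integrable_fin_num (hk_integrable b1 (lexx _) (lexx _)).
split => [h|h]; first by rewrite [X in fine X]h.
by rewrite -[LHS](fineK fin) h.
Qed.

(* [D0, b0] and [D1, b1] are the values of D and b at [y - d] and [y], [l = - ln y], and [e]
   is the second-order remainder of D. *)
Lemma hk_potential_step (beta gamma eps L y d l e D0 D1 b0 b1 : R) :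
  1 < beta -> 0 <= gamma -> 0 < eps -> 0 <= d -> 0 <= y -> y <= 1 ->
  0 <= l <= L -> 0 <= e <= d ^+ 2 / eps ->
  D1 = y + y * l + beta - 1 -> D1 - D0 = l * d + e ->
  d <= 1 ->
  beta - 1 <= D0 <= beta -> beta - 1 <= D1 <= beta -> 0 <= b1 <= 1 ->
  0 <= 1 - gamma * (1 - y) + l * b1 ->
  (b1 - b0) * D0 <= d * (1 - gamma * (1 - y) + l * b1) ->
  1 < gamma * beta ->
  (b1 - gamma * y) / D1 - (b0 - gamma * (y - d)) / D0 <=
    - ((gamma * beta - 1) / beta ^+ 2) * d +
    (((1 + L) * (L + eps^-1) / (beta - 1) + gamma / eps) / (beta - 1) ^+ 2) * d ^+ 2.
Proof.
move=> be1 g0 eps0 d0 y0 y1 /andP[l0 lL] /andP[e0 ee] D1E DE d1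
  /andP[D0m D0M] /andP[D1m D1M] /andP[b10 b11].
set c := 1 - gamma * (1 - y) + l * b1 => c0 uc gb.
set u := b1 - b0 in uc *.
have m0 : 0 < beta - 1 by rewrite subr_gt0.
set m := beta - 1 in D0m D1m m0 *.
have D0p : 0 < D0 by exact: lt_le_trans D0m.
have D1p : 0 < D1 by exact: lt_le_trans D1m.
have L0 : 0 <= L by exact: le_trans lL.
have ieps : 0 < eps^-1 by rewrite invr_gt0.
have cL : c <= 1 + L.
  have : l * b1 <= L * 1 by exact: ler_pM.
  by rewrite /c; have := mulr_ge0 g0 (_ : 0 <= 1 - y); rewrite subr_ge0 => /(_ y1); lra.
(* [D0] may be replaced by its lower bound only when u >= 0; a negative [u] satisfies the claim at
   once. *)
have um : u <= d * (1 + L) / m.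
  rewrite ler_pdivlMr//; have [u0|u0] := leP 0 u.
    apply: (le_trans (ler_wpM2l u0 D0m)); apply: (le_trans uc).
    exact: ler_wpM2l.
  apply: (@le_trans _ _ 0); first by rewrite mulr_le0_ge0// ltW.
  by rewrite mulr_ge0// addr_ge0.
have eLd : l * d + e <= (L + eps^-1) * d.
  have : l * d <= L * d by exact: ler_wpM2r.
  have : d ^+ 2 / eps <= d / eps.
    by rewrite ler_wpM2r ?(ltW ieps)// expr2 ler_piMr.
  by rewrite mulrDl [eps^-1 * d]mulrC; lra.
have le0 : 0 <= l * d + e by rewrite addr_ge0// mulr_ge0.
have X0 : 0 <= d * (1 + L) / m by rewrite divr_ge0 ?(ltW m0)// mulr_ge0// addr_ge0.
have uD : u * (D1 - D0) <= (d * (1 + L) / m) * ((L + eps^-1) * d).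
  rewrite DE; apply: (le_trans (ler_wpM2r le0 um)); exact: ler_wpM2l.
have ge : gamma * y * e <= gamma * (d ^+ 2 / eps).
  rewrite -mulrA ler_wpM2l//; apply: le_trans ee; by rewrite ler_piMl.
have be : 0 <= b1 * e by exact: mulr_ge0.
set K0 := (1 + L) * (L + eps^-1) / m + gamma / eps.
have K00 : 0 <= K0.
  by rewrite addr_ge0 ?divr_ge0 ?(ltW m0) ?(ltW eps0)// mulr_ge0 ?addr_ge0 ?(ltW ieps).
(* By [u * D0 <= d * c] and the formula for [D1], the first-order terms collapse to (1 - gamma beta)
   d. The term - b1 e is dropped, and u (D1 - D0) and gamma y e are quadratic in d. *)
have NE : (b1 - gamma * y) * D0 - (b0 - gamma * (y - d)) * D1
    <= - (gamma * beta - 1) * d + K0 * d ^+ 2.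
  have -> : (b1 - gamma * y) * D0 - (b0 - gamma * (y - d)) * D1 =
     - (b1 - gamma * y) * (D1 - D0) + u * D0 + u * (D1 - D0) - gamma * d * D1.
    by rewrite /u; ring.
  have -> : K0 * d ^+ 2 = d * (1 + L) / m * ((L + eps^-1) * d) + gamma * (d ^+ 2 / eps).
    by rewrite /K0; ring.
  have -> : - (b1 - gamma * y) * (D1 - D0) =
      - b1 * l * d - b1 * e + gamma * y * l * d + gamma * y * e by rewrite DE; ring.
  rewrite [in gamma * d * D1]D1E.
  have -> : - (gamma * beta - 1) * d = d * c - b1 * l * d + gamma * y * l * d
      - gamma * d * (y + y * l + beta - 1) by rewrite /c; ring.
  by lra.
have -> : (b1 - gamma * y) / D1 - (b0 - gamma * (y - d)) / D0 =
   ((b1 - gamma * y) * D0 - (b0 - gamma * (y - d)) * D1) / (D0 * D1).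
  by field; rewrite !gt_eqF.
have DD0 : 0 < D0 * D1 by exact: mulr_gt0.
apply: (@le_trans _ _ ((- (gamma * beta - 1) * d + K0 * d ^+ 2) / (D0 * D1))).
  by rewrite ler_wpM2r// invr_ge0 ltW.
(* The linear term is negative and needs D0 D1 <= beta^2; the quadratic one is nonnegative and needs
   D0 D1 >= (beta - 1)^2. *)
rewrite mulrDl lerD//.
  rewrite !mulNr lerN2 mulrAC ler_wpM2l//.
    by rewrite mulr_ge0// subr_ge0 ltW.
  by rewrite lef_pV2 ?posrE ?exprn_gt0 ?(lt_trans _ be1)// expr2 ler_pM// ltW.
rewrite mulrAC ler_wpM2r ?sqr_ge0// ler_wpM2l//.
by rewrite lef_pV2 ?posrE ?exprn_gt0// expr2 ler_pM// ltW.
Qed.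

(** By contradiction: if gamma beta > 1, the quotient [phi] loses at least delta (1 - eps) on
    [eps, 1], more than its value at [eps], although phi 1 >= 0. *)
Lemma prophet_bound (beta gamma : R) (H : R -> R) :
  1 < beta -> beta_eq beta -> 0 <= gamma ->
  nondecreasing_fun H -> H 0 = 0 -> H 1 <= 1 ->
  gamma <= \int[mu]_(t in `[0, 1]) (1 - H t) ->
  (forall y T, 0 < y <= 1 -> 0 <= T <= 1 ->
    gamma * (1 - y) <= H T - ln y * \int[mu]_(t in `[T, 1]) (1 - H t)) ->
  gamma <= 1 / beta.
Proof.
move=> be1 be_eq g0 Hnd H0 H1 gB gyT.
have b0 : 0 < beta by exact: lt_trans be1.
have m0 : 0 < beta - 1 by rewrite subr_gt0.
rewrite ler_pdivlMr// leNgt; apply/negP => gb.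
pose D := hk_den beta.
pose B t := \int[mu]_(x in `[t, 1]) (1 - H x).
pose T y := \int[mu]_(x in `[y, 1]) (D x)^-1.
have Hb t : 0 <= t <= 1 -> 0 <= 1 - H t <= 1.
  move=> /andP[t0 t1]; have := Hnd _ _ t0; have := Hnd _ _ t1; lra.
have Hi a b : 0 <= a -> b <= 1 -> mu.-integrable `[a, b] (EFin \o (fun t => 1 - H t)).
  move=> a0 b1; apply: (@itv_integrableS _ _ 0 _ _ 1) => //.
  apply: (@bounded_itv_integrable _ _ _ _ 0 1) => //.
  apply: measurable_funB; first exact: measurable_cst.
  exact: nondecreasing_measurable.
have Di a b : 0 <= a -> b <= 1 -> mu.-integrable `[a, b] (EFin \o (fun y => (D y)^-1)).
  exact: hk_integrable.
have D0 y : 0 <= y <= 1 -> 0 < D y by move=> /(hk_den_ge beta); apply: lt_le_trans.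
have T_int : T 0 = 1 by apply/beta_eqE.
have T1 : T 1 = 0 by rewrite /T set_itv1 Rintegral_set1.
have Tsplit x y : 0 <= x -> x <= y -> y <= 1 ->
    T x = \int[mu]_(z in `[x, y]) (D z)^-1 + T y.
  by move=> x0 xy y1; apply: Rintegral_itv_split => //; exact: Di.
have Tnd x y : 0 <= x -> x <= y -> y <= 1 -> T y <= T x.
  move=> x0 xy y1; rewrite (Tsplit x y)// lerDr.
  apply: Rintegral_ge0 => z /=; rewrite in_itv/= => /andP[xz zy].
  by rewrite invr_ge0 ltW// D0//; lra.
have T01 y : 0 <= y <= 1 -> 0 <= T y <= 1.
  by move=> /andP[y0 y1]; rewrite -T_int -[X in X <= T y]T1 !Tnd.
have Bsplit s t : 0 <= s -> s <= t -> t <= 1 ->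
    B s = \int[mu]_(x in `[s, t]) (1 - H x) + B t.
  by move=> s0 st t1; apply: Rintegral_itv_split => //; exact: Hi.
have B_ge0 t : 0 <= t -> 0 <= B t.
  move=> t0; apply: Rintegral_ge0 => z /=; rewrite in_itv/= => /andP[tz z1].
  by have /andP[] : 0 <= 1 - H z <= 1 by apply: Hb; lra.
have B_le t : 0 <= t <= 1 -> B t <= 1 - t.
  move=> /andP[t0 t1]; rewrite -[leRHS]mul1r; apply: Rintegral_itv_le => //.
    exact: Hi.
  move=> z /andP[tz z1].
  by have /andP[] : 0 <= 1 - H z <= 1 by apply: Hb; lra.
pose delta := (gamma * beta - 1) / beta ^+ 2.
have delta0 : 0 < delta by rewrite divr_gt0 ?subr_gt0// exprn_gt0.
(* The descent stops short of 0, where D' = - ln y is unbounded and [K] would blow up. The two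
   bounds on [eps] give a drop of at least delta / 2 against phi eps <= delta / 4. *)
pose eps := Num.min (1 / 2) (delta * (beta - 1) ^+ 2 / 4).
have eps0 : 0 < eps.
  by rewrite lt_min divr_gt0//= !divr_gt0// mulr_gt0// exprn_gt0.
have eps_half : eps <= 1 / 2 by rewrite ge_min lexx.
have eps_small : eps / (beta - 1) ^+ 2 <= delta / 4.
  rewrite ler_pdivrMr ?exprn_gt0// /eps ge_min; apply/orP; right.
  by rewrite mulrAC.
pose phi y := (B (T y) - gamma * y) / D y.
pose L := - ln eps.
pose K := ((1 + L) * (L + eps^-1) / (beta - 1) + gamma / eps) / (beta - 1) ^+ 2.
have drop : phi 1 + delta * 1 <= phi eps + delta * eps.
  apply: (@quadratic_error_nonincreasing _ (fun y => phi y + delta * y) eps 1 K).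
    by lra.
  move=> x y ex xy y1; have x0 : 0 < x by exact: lt_le_trans ex.
  have y0 : 0 < y by exact: lt_le_trans xy.
  have Dxy : D x <= D y by exact: hk_den_le_homo.
  have Dx0 : 0 < D x by apply: D0; lra.
  have xI : 0 <= x <= 1 by lra.
  have yI : 0 <= y <= 1 by lra.
  have /andP[Ty0 Ty1] := T01 _ yI; have /andP[Tx0 Tx1] := T01 _ xI.
  have HTy : 0 <= 1 - H (T y) <= 1 by apply: Hb; rewrite Ty0.
  have Txy : T y <= T x by apply: Tnd => //; exact: ltW.
  have TT : T x - T y <= (y - x) / D x.
    rewrite (Tsplit x y) ?(ltW x0)// addrK mulrC.
    apply: Rintegral_itv_le => //; first by rewrite Di ?(ltW x0).
    move=> z /andP[xz zy]; rewrite lef_pV2 ?posrE ?D0//; last by lra.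
    by apply: hk_den_le_homo => //; lra.
  have BB : B (T y) - B (T x) <= (1 - H (T y)) * (T x - T y).
    rewrite (Bsplit (T y) (T x))// addrK.
    apply: Rintegral_itv_le => //; first exact: Hi.
    by move=> z /andP[Tz _]; rewrite lerD2l lerN2; exact: Hnd.
  (* The averaged constraint, taken at the time [T y], bounds the factor 1 - H(T y) of [BB]. *)
  have key : 1 - H (T y) <= 1 - gamma * (1 - y) + (- ln y) * B (T y).
    have yI' : 0 < y <= 1 by rewrite y0.
    have := gyT y (T y) yI' (T01 _ yI).
    rewrite mulNr -/(B (T y)).
    set u := gamma * _; set v := ln y * _.
    by clear; lra.
  have /andP[HT0 HT1] := HTy.
  have := @hk_potential_step beta gamma eps L y (y - x) (- ln y)
    (D y - D x + ln y * (y - x)) (D x) (D y) (B (T x)) (B (T y)).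
  rewrite subKr -/delta -/K /phi.
  have -> : forall a b u v : R, a + delta * u - (b + delta * v) =
     (a - b) + delta * (u - v) by move=> *; ring.
  move=> step; rewrite -lerBrDr [leRHS]addrC -(mulNr delta); apply: step => //.
  - by rewrite subr_ge0.
  - exact: ltW.
  - rewrite oppr_ge0 ln_le0//= lerN2 ler_ln ?posrE//; exact: le_trans xy.
  - have /andP[-> /le_trans] := hk_den_diff beta x0 xy; apply.
    rewrite ler_wpM2l ?sqr_ge0// lef_pV2 ?posrE//; exact: le_trans xy.
  - by rewrite /D /hk_den; ring.
  - by ring.
  - by clear -x0 y1; lra.
  - by rewrite hk_den_ge ?hk_den_le.
  - by rewrite hk_den_ge ?hk_den_le.
  - by rewrite B_ge0//=; apply: le_trans (B_le _ _) _; rewrite ?Ty0// gerBl.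
  - exact: le_trans key.
  - apply: (@le_trans _ _ ((1 - H (T y)) * (T x - T y) * D x)).
      by rewrite ler_wpM2r// ltW.
    rewrite -mulrA mulrC ler_pM//.
      by apply: mulr_ge0; [rewrite subr_ge0|exact: ltW].
    by rewrite -ler_pdivlMr.
(* As T 1 = 0, the numerator is nonnegative by the bound [gB] on the integral of 1 - H over
   [0, 1]. *)
have phi1 : 0 <= phi 1.
  rewrite /phi T1 mulr1; apply: divr_ge0; first by rewrite subr_ge0.
  by apply: ltW; apply: D0; rewrite ler01 lexx.
(* [T eps] is within eps / (beta - 1) of T 0 = 1, and B t <= 1 - t. *)
have phie : phi eps <= eps / (beta - 1) ^+ 2.
  have eI : 0 <= eps <= 1 by lra.
  have De := hk_den_ge beta eI.
  have Te : T 0 - T eps <= eps / (beta - 1).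
    rewrite (Tsplit 0 eps) ?(ltW eps0)//; last by lra.
    rewrite addrK mulrC -[X in _ * X]subr0; apply: Rintegral_itv_le; rewrite ?(ltW eps0)//.
      by rewrite Di//; lra.
    move=> z /andP[z0 ze]; rewrite lef_pV2 ?posrE ?D0//; try lra.
    by apply: hk_den_ge; lra.
  have Be : B (T eps) <= eps / (beta - 1).
    by apply: (le_trans (B_le _ (T01 _ eI))); rewrite -[X in X - _ <= _]T_int.
  rewrite /phi ler_pdivrMr ?D0//.
  apply: (@le_trans _ _ (eps / (beta - 1))).
    by apply: le_trans Be; rewrite gerBl mulr_ge0// ltW.
  have -> : eps / (beta - 1) = eps / (beta - 1) ^+ 2 * (beta - 1).
    by field; rewrite gt_eqF.
  by rewrite ler_wpM2l// divr_ge0 ?sqr_ge0// ltW.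
have : delta * eps <= delta * (1 / 2) by rewrite ler_wpM2l// ltW.
by lra.
Qed.
End prophet_bound.

(** * Existence and uniqueness of beta *)

Section hk_integral.
Variable R : realType.
Let mu := @lebesgue_measure R.

Definition hk_int (beta : R) : R := \int[mu]_(y in `[0, 1]) (hk_den beta y)^-1.

(** The integrands differ by (b - a) / (D_a D_b), with both denominators between m - 1 and b. The
    lower bound gives strict decrease of [hk_int], the upper one Lipschitz continuity. *)
Lemma hk_int_diff (m a b : R) : 1 < m -> m <= a -> a <= b ->
  (b - a) / b ^+ 2 <= hk_int a - hk_int b <= (b - a) / (m - 1) ^+ 2.
Proof.
move=> m1 ma ab; have a1 := lt_le_trans m1 ma; have b1 := lt_le_trans a1 ab.
have mm : 0 < m - 1 by rewrite subr_gt0.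
have ba : 0 <= b - a by rewrite subr_ge0.
have ai := hk_integrable a1 (lexx 0) (lexx 1).
have bi := hk_integrable b1 (lexx 0) (lexx 1).
have abi := integrableB _ ai bi.
rewrite /hk_int -RintegralB//.
have E y : 0 <= y <= 1 -> (hk_den a y)^-1 - (hk_den b y)^-1 =
    (b - a) / (hk_den a y * hk_den b y).
  move=> y01; have := hk_den_ge a y01; have := hk_den_ge b y01 => h1 h2.
  have -> : b - a = hk_den b y - hk_den a y by rewrite /hk_den; ring.
  by field; rewrite !gt_eqF//; lra.
apply/andP; split.
  rewrite -[leLHS]mulr1 -[X in _ * X]subr0; apply: Rintegral_itv_ge => //.
    exact: abi.
  move=> y y01; rewrite E// ler_wpM2l//.
  have := hk_den_ge a y01; have := hk_den_ge b y01.
  have := hk_den_le a y01; have := hk_den_le b y01 => *.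
  by rewrite lef_pV2 ?posrE ?exprn_gt0 ?mulr_gt0// ?expr2 ?ler_pM//; lra.
rewrite -[leRHS]mulr1 -[X in _ * X]subr0; apply: Rintegral_itv_le => //.
  exact: abi.
move=> y y01; rewrite E// ler_wpM2l//.
have := hk_den_ge a y01; have := hk_den_ge b y01 => *.
by rewrite lef_pV2 ?posrE ?exprn_gt0 ?mulr_gt0// ?expr2 ?ler_pM//; lra.
Qed.

Lemma hk_int_2 : hk_int 2 <= 1.
Proof.
rewrite -[leRHS]mulr1 -[X in _ * X]subr0; apply: Rintegral_itv_le => //.
  by apply: hk_integrable; rewrite // ltr1n.
by move=> y /(hk_den_ge 2) h; rewrite invf_le1; lra.
Qed.

(** The left side is concave with tangent exp (- 1 / 2) + y / 2 at exp (- 1 / 2), and exp (1 / 2) >=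
    3 / 2. *)
Lemma entropy_le_tangent (y : R) : 0 <= y -> y * (1 - ln y) <= 2 / 3 + y / 2.
Proof.
rewrite le_eqVlt => /predU1P[<-|y0]; first by rewrite mul0r; lra.
have := ler_wpM2l (ltW y0) (ln_ge_1BV (mulr_gt0 (expR_gt0 2^-1) y0)).
rewrite lnM ?posrE ?expR_gt0// expRK invfM mulrBr mulrCA divff ?gt_eqF// mulr1.
have : (expR (2^-1 : R))^-1 <= 2 / 3.
  have -> : 2 / 3 = (3 / 2)^-1 :> R by field.
  rewrite lef_pV2 ?posrE ?expR_gt0//.
  by apply: le_trans (expR_ge1Dx _); lra.
by lra.
Qed.

(** The value 13 / 12 is chosen so that the affine minorant 3 / 4 + (1 - y) / 2 of 1 / D has
    integral exactly 1. *)
Lemma hk_int_13_12 : 1 <= hk_int (13 / 12).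
Proof.
have b1 : 1 < 13 / 12 :> R by lra.
have i1 : mu.-integrable `[0, 1] (EFin \o (fun y : R => (1 - y) ^+ 1)).
  apply: (@bounded_itv_integrable _ _ _ _ 0 1) => //.
    by apply: measurable_funB; [exact: measurable_cst|exact: measurable_id].
  by move=> y; rewrite expr1; lra.
have i2 : mu.-integrable `[0, 1] (EFin \o (fun y : R => 1 / 2 * (1 - y) ^+ 1)).
  by apply: (integrableZl _ (1 / 2) i1).
have i3 := integrable_itv_cst 0 1 (3 / 4 : R).
have E : \int[mu]_(y in `[0, 1]) (3 / 4 + 1 / 2 * (1 - y) ^+ 1) = 1.
  rewrite RintegralD//= Rintegral_itv_cst// RintegralZl//.
  have /= -> := @Rintegral_onemXn R 1.
  by lra.
rewrite -[leLHS]E; apply: le_Rintegral => //.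
- by apply: (integrableD _ i3 i2).
- exact: hk_integrable.
- move=> y; rewrite /= in_itv/= => /[dup] yI /(hk_den_ge (13 / 12)) h.
  have D0 : 0 < hk_den (13 / 12) y by lra.
  have /andP[/entropy_le_tangent y0 _] := yI.
  (* [1 / D >= 2 - D], and [D] lies below its tangent at [y = expR (- 1 / 2)]. *)
  apply: (@le_trans _ _ (2 - hk_den (13 / 12) y)).
    by rewrite expr1 /hk_den; lra.
  rewrite -[leRHS]mul1r ler_pdivlMr//.
  by have := sqr_ge0 (hk_den (13 / 12) y - 1); nra.
Qed.

Lemma beta_eq_exists_unique : exists! beta : R, 1 < beta /\ beta_eq beta.
Proof.
pose c : R := 13 / 12.
have c1 : 1 < c by rewrite /c; lra.
(* Frozen below [c], the integral is Lipschitz in beta on the whole line, so the intermediate value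
   theorem applies between [c] and 2. *)
pose J x := hk_int (Num.max c x).
pose K := (c - 1) ^- 2.
have K0 : 0 < K by rewrite invr_gt0 exprn_gt0// subr_gt0.
have JK x y : x <= y -> `|J x - J y| <= K * (y - x).
  move=> xy; have mxy : Num.max c x <= Num.max c y.
    by rewrite ge_max !le_max lexx xy orbT.
  have cx : c <= Num.max c x by rewrite le_max lexx.
  have /andP[l u] := hk_int_diff c1 cx mxy.
  rewrite ger0_norm.
    apply: (le_trans u); rewrite mulrC ler_wpM2l ?(ltW K0)//.
    rewrite /Num.max; case: ltP => h1; case: ltP => h2; lra.
  apply: le_trans l; rewrite divr_ge0 ?sqr_ge0// subr_ge0//.
have Jc : continuous J.
  move=> x; apply/cvgrPdist_le => e e0.
  near=> y.
  apply: (@le_trans _ _ (K * `|x - y|)).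
    have [xy|/ltW yx] := leP x y; first by rewrite (distrC x) (ger0_norm (_ : 0 <= y - x)) ?subr_ge0// JK.
    by rewrite (distrC (J x)) (ger0_norm (_ : 0 <= x - y)) ?subr_ge0// JK.
  rewrite mulrC -ler_pdivlMr//; near: y.
  by apply: cvgr_dist_le => //; rewrite divr_gt0.
have c2 : c <= 2 by rewrite /c; lra.
have [] := @IVT R J c 2 1 c2 (continuous_subspaceT Jc).
  rewrite ge_min le_max /J maxxx (max_idPr c2) hk_int_13_12 hk_int_2 orbT//.
move=> beta; rewrite in_itv/= => /andP[cb b2]; rewrite /J (max_idPr cb) => be.
have b1 : 1 < beta by exact: lt_le_trans cb.
have lt_neq (a b : R) : 1 < a -> a < b -> hk_int b < hk_int a.
  move=> a1 ab; have /andP[+ _] := hk_int_diff a1 (lexx a) (ltW ab).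
  rewrite -subr_gt0; apply: lt_le_trans; rewrite divr_gt0 ?subr_gt0// exprn_gt0//.
  by lra.
exists beta; split; first by split => //; apply/beta_eqE.
move=> b' [b1' /(beta_eqE b1')]; rewrite -/(hk_int b') => be'.
have [lt|lt|//] := ltgtP beta b'.
- by have := lt_neq _ _ b1 lt; rewrite be be' ltxx.
- by have := lt_neq _ _ b1' lt; rewrite be be' ltxx.
Unshelve. all: by end_near. Qed.
End hk_integral.

(** * Averaging over a Poisson law *)

Section averages.
Variable R : realType.

(** The first moment of the unnormalised Poisson weights: k x^k / k! = x x^(k-1) / (k-1)!, hence the
    shift by one term. *)
Lemma series_exp_coeffM (x : R) n :
  \sum_(0 <= k < n.+1) k%:R * exp_coeff x k = x * series (exp_coeff x) n.
Proof.
rewrite big_nat_recl// mul0r add0r /series/= big_distrr/=.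
apply: eq_bigr => k _; rewrite /exp_coeff/= factS exprS natrM.
by field; rewrite addrC natr1 !pnatr_eq0 -lt0n fact_gt0.
Qed.

(* Integrating the hypothesis against the Poisson law of parameter [x]. *)
Lemma poisson_average (a c g z x : R) : 0 <= x ->
  (forall k : nat, g * (1 - z ^+ k) <= a + c * k%:R) ->
  g * (1 - expR (- (x * (1 - z)))) <= a + c * x.
Proof.
move=> x0 h; pose S u n := series (exp_coeff (u : R)) n.
have Sc u : S u n @[n --> \oo] --> expR u by exact: is_cvg_series_exp_coeff.
have Sc1 u : S u n.+1 @[n --> \oo] --> expR u by move: (Sc u); rewrite -cvg_shiftS.
(* The weights x^k / k! are left unnormalised: their sums against z^k tend to exp (x z), and
   division by exp x comes after the limit. *)
have le n : g * (S x n.+1 - S (x * z) n.+1) <= a * S x n.+1 + c * (x * S x n).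
  rewrite -series_exp_coeffM /S /series/= -sumrB !big_distrr/= -big_split/=.
  apply: ler_sum => k _; have := exp_coeff_ge0 k x0 => e0.
  have -> : exp_coeff (x * z) k = exp_coeff x k * z ^+ k.
    by rewrite /exp_coeff/= exprMn mulrAC.
  by have := ler_wpM2r e0 (h k); lra.
have lim : g * (expR x - expR (x * z)) <= a * expR x + c * (x * expR x).
  have l1 : g * (S x n.+1 - S (x * z) n.+1) @[n --> \oo] -->
      g * (expR x - expR (x * z)).
    exact: (cvgM (cvg_cst g) (cvgB (Sc1 x) (Sc1 (x * z)))).
  have l2 : a * S x n.+1 + c * (x * S x n) @[n --> \oo] -->
      a * expR x + c * (x * expR x).
    exact: (cvgD (cvgM (cvg_cst a) (Sc1 x))
                 (cvgM (cvg_cst c) (cvgM (cvg_cst x) (Sc x)))).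
  by apply: (ler_cvg_to l1 l2); apply: nearW => n; exact: le.
have -> : - (x * (1 - z)) = x * z - x by ring.
rewrite expRB -(ler_pM2r (expR_gt0 x)).
have -> : g * (1 - expR (x * z) / expR x) * expR x = g * (expR x - expR (x * z)).
  by field; rewrite gt_eqF// expR_gt0.
by apply: le_trans lim _; rewrite le_eqVlt; apply/orP; left; apply/eqP; ring.
Qed.

(** * Binomial and negative binomial weights *)

Definition binom_weight (k j : nat) (t : R) : R := 'C(k, j)%:R * t ^+ j * (1 - t) ^+ (k - j).

Lemma binom_weight_ge0 k j t : 0 <= t <= 1 -> 0 <= binom_weight k j t.
Proof. by move=> /andP[t0 t1]; rewrite !mulr_ge0 ?exprn_ge0 ?subr_ge0. Qed.

Lemma sum_binom_weight k t : \sum_(0 <= j < k.+1) binom_weight k j t = 1.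
Proof.
rewrite big_mkord -[RHS](expr1n R k) -[in RHS](subrK t 1) exprDn.
by apply: eq_bigr => j _; rewrite /binom_weight -mulr_natr; ring.
Qed.

Lemma binom_weightS0 k t : binom_weight k.+1 0 t = binom_weight k 0 t - t * binom_weight k 0 t.
Proof. by rewrite /binom_weight !bin0 !subn0 exprS; ring. Qed.

Lemma binom_weightSS k j t : binom_weight k.+1 j.+1 t =
  t * binom_weight k j t + (1 - t) * binom_weight k j.+1 t.
Proof.
rewrite /binom_weight binS natrD subSS; have [kj|jk] := leqP k j.
  by rewrite bin_small//= !exprS; ring.
by rewrite -(subnSK jk) !exprS; ring.
Qed.

(** Pascal's rule telescopes: at most r successes turns into more only when exactly r have occurred
    and the new trial succeeds. *)
Lemma sum_binom_weightS k r t :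
  \sum_(0 <= j < r.+1) binom_weight k.+1 j t =
  \sum_(0 <= j < r.+1) binom_weight k j t - t * binom_weight k r t.
Proof.
elim: r => [|r IH]; first by rewrite !big_nat1 binom_weightS0.
rewrite big_nat_recr//= IH [in RHS]big_nat_recr//= binom_weightSS; ring.
Qed.

(* The [(r+1)]-st success occurs by trial [r + n] unless at most [r] successes occur. *)
Lemma negative_binomial_cdf r n t :
  \sum_(r.+1 <= l < (r + n).+1) 'C(l.-1, r)%:R * t ^+ r.+1 * (1 - t) ^+ (l - r.+1) =
  1 - \sum_(0 <= j < r.+1) binom_weight (r + n) j t.
Proof.
elim: n => [|n IH]; first by rewrite addn0 big_geq// sum_binom_weight subrr.
rewrite addnS big_nat_recr/= ?ltnS ?leq_addr// IH sum_binom_weightS.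
by rewrite /binom_weight subSS exprS; ring.
Qed.

(** The inner sum of [clp_value]. For s >= 1 and t in [0, 1] it is the probability that the s-th
    success in independent trials of success probability t comes by trial k. *)
Definition rank_weight (k : nat) (t : R) (s : nat) : R :=
  \sum_(s <= l < k.+1) 'C(l.-1, s.-1)%:R * t ^+ s * (1 - t) ^+ (l - s).

Lemma rank_weight_ge0 k t s : 0 <= t <= 1 -> 0 <= rank_weight k t s.
Proof.
move=> /andP[t0 t1]; apply: sumr_ge0 => l _.
by rewrite !mulr_ge0 ?exprn_ge0 ?subr_ge0.
Qed.

Lemma rank_weight_le1 k t s : 0 <= t <= 1 -> (0 < s <= k)%N -> rank_weight k t s <= 1.
Proof.
case: s => // r t01 /= rk; rewrite /rank_weight/=.
have := negative_binomial_cdf r (k - r) t; rewrite subnKC ?(ltnW rk)// => ->.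
by rewrite gerBl; apply: sumr_ge0 => j _; exact: binom_weight_ge0.
Qed.

(** One factor t is split off, to be spent on the constraint t alpha(t, s) <= 1 - H(t). *)
Definition rank_weight' (k : nat) (t : R) (s : nat) : R :=
  \sum_(s <= l < k.+1) 'C(l.-1, s.-1)%:R * t ^+ s.-1 * (1 - t) ^+ (l - s).

Lemma rank_weightE k t s : (0 < s)%N -> rank_weight k t s = t * rank_weight' k t s.
Proof.
case: s => // r _; rewrite /rank_weight /rank_weight' big_distrr/=.
by apply: eq_bigr => l _; rewrite exprS; ring.
Qed.

Lemma rank_weight'_ge0 k t s : 0 <= t <= 1 -> 0 <= rank_weight' k t s.
Proof.
move=> /andP[t0 t1]; apply: sumr_ge0 => l _.
by rewrite !mulr_ge0 ?exprn_ge0 ?subr_ge0.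
Qed.

(** Raising k by one adds the trial l = k + 1, whose terms over all s are the binomial weights of k
    and sum to 1. *)
Lemma sum_rank_weight' k t : \sum_(1 <= s < k.+1) rank_weight' k t s = k%:R.
Proof.
elim: k => [|k IH]; first by rewrite big_geq.
transitivity (\sum_(1 <= s < k.+2) (rank_weight' k t s + binom_weight k s.-1 t)).
  apply: eq_big_nat => s /andP[s0 sk]; rewrite /rank_weight' big_nat_recr//=.
  by case: s s0 sk => // s _ sk; rewrite /binom_weight subSS.
rewrite big_split/= big_nat_recr//= IH.
have -> : rank_weight' k t k.+1 = 0 by rewrite /rank_weight' big_geq.
rewrite addr0.
by rewrite big_add1/= sum_binom_weight natr1.
Qed.

End averages.

(** * The acceptance mass of a feasible solution, and the two bounds on gamma *)

Section reservoir.
Variable R : realType.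
Let mu := @lebesgue_measure R.
Implicit Types (alpha : R -> nat -> R) (p gamma t : R).

Definition total_rate alpha t : \bar R :=
  (\sum_(1 <= s <oo) (alpha t s)%:E)%E.

Lemma total_rate_ge0 alpha t : (forall s, 0 <= alpha t s) ->
  (0 <= total_rate alpha t)%E.
Proof. by move=> a0; apply: nneseries_ge0 => s _ _; rewrite lee_fin. Qed.

Lemma sum_le_total_rate alpha t n : (forall s, 0 <= alpha t s) ->
  ((\sum_(1 <= s < n) alpha t s)%:E <= total_rate alpha t)%E.
Proof.
move=> a0; rewrite -sumEFin; apply: nneseries_lim_ge => s _ _.
by rewrite lee_fin.
Qed.

Lemma measurable_total_rate alpha :
  (forall s, measurable_fun (`[0, 1] : set R) (fun t => alpha t s)) ->
  (forall t s, 0 <= t <= 1 -> 0 <= alpha t s) ->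
  measurable_fun (`[0, 1] : set R) (total_rate alpha).
Proof.
move=> ma a0.
have -> : total_rate alpha =
    fun t => (\sum_(0 <= s <oo | s \in [pred s | 0 < s]%N) (alpha t s)%:E)%E.
  apply/funext => t; congr (limn _); apply/funext => n.
  by rewrite (@big_nat_widenl _ _ _ 1 0)//; apply: eq_bigl => s.
apply: ge0_emeasurable_sum => [s t|s _].
  by rewrite /= in_itv/= => t01 _; rewrite lee_fin a0.
exact/measurable_EFinP.
Qed.

(* Frozen after [t = 1], because [alpha] is unconstrained outside [[0, 1]]. *)
Definition reservoir p alpha t : R := p * fine (clp_mass alpha (Num.min 1 t)).

Lemma reservoir0 p alpha : reservoir p alpha 0 = 0.
Proof.
rewrite /reservoir (min_idPr ler01) /clp_mass set_itv1 integral_set1.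
by rewrite mulr0.
Qed.

Section feasible.
Variables (p gamma : R) (alpha : R -> nat -> R).
Hypotheses (p0 : 0 < p) (fea : clp_feasible p gamma alpha).

Let a0 t s : 0 <= t <= 1 -> 0 <= alpha t s.
Proof. by case: fea => _ _ + _ _ => /[apply] /(_ s) /andP[]. Qed.

Let mA : measurable_fun (`[0, 1] : set R) (total_rate alpha).
Proof. by apply: measurable_total_rate => //; case: fea. Qed.

Let mA_ab (i : interval R) : [set` i] `<=` `[0, 1] -> measurable_fun [set` i] (total_rate alpha).
Proof. by move=> h; exact: measurable_funS mA. Qed.

Let A0 t : 0 <= t <= 1 -> (0 <= total_rate alpha t)%E.
Proof. by move=> t01; apply: total_rate_ge0 => s; exact: a0. Qed.

Let mass_ge0 t : t <= 1 -> (0 <= clp_mass alpha t)%E.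
Proof.
move=> t1; apply: integral_ge0 => x /=; rewrite in_itv/= => /andP[x0 xt].
by apply: A0; rewrite x0 (le_trans xt).
Qed.

Let mass_le s t : s <= t -> t <= 1 -> (clp_mass alpha s <= clp_mass alpha t)%E.
Proof.
move=> st t1; apply: ge0_subset_integral => //.
- by apply: mA_ab; apply: subset_itv; rewrite bnd_simp.
- move=> x /=; rewrite in_itv/= => /andP[x0 xt].
  by apply: A0; rewrite x0 (le_trans xt).
- by apply: subset_itv; rewrite bnd_simp.
Qed.

Let mass_fin t : t <= 1 -> clp_mass alpha t \is a fin_num.
Proof.
move=> t1; rewrite ge0_fin_numE ?mass_ge0//.
apply: (le_lt_trans (mass_le t1 (lexx _))).
(* Infinite mass would make the right side of the capacity constraint at t = 1, s = 1 equal to -oo,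
   as p > 0. *)
case: fea => _ _ _ /(_ 1 1%N) + _.
rewrite lexx ler01 => /(_ isT isT).
case: (clp_mass alpha 1) (mass_ge0 (lexx 1)) => [r| |]//= _; first by rewrite ltry.
by rewrite gt0_muley ?lte_fin.
Qed.

Lemma reservoir_nondecreasing : nondecreasing_fun (reservoir p alpha).
Proof.
move=> s t st; rewrite ler_wpM2l ?(ltW p0)// fine_le ?mass_fin ?ge_min ?lexx//.
by apply: mass_le; [rewrite le_min !ge_min lexx st orbT|rewrite ge_min lexx].
Qed.

Lemma mul_alpha_le t s : 0 <= t <= 1 -> (1 <= s)%N ->
  t * alpha t s <= 1 - reservoir p alpha t.
Proof.
move=> t01 s1; have /andP[_ t1] := t01.
case: fea => _ _ _ /(_ t s t01 s1) + _.
by rewrite -(fineK (mass_fin t1)) -EFinM -EFinB lee_fin /reservoir (min_idPr t1).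
Qed.

Lemma reservoir_le1 : reservoir p alpha 1 <= 1.
Proof.
rewrite -subr_ge0; apply: le_trans (mul_alpha_le (s := 1) _ _) => //.
  by rewrite mul1r a0// lexx ler01.
by rewrite lexx ler01.
Qed.

(** The minorant [g] of the total rate is alpha(., 1) for the first bound and the k-th integrand for
    the second. *)
Lemma le_reservoirB (g : R -> R) a b : 0 <= a -> a <= b -> b <= 1 ->
  mu.-integrable `[a, b] (EFin \o g) ->
  (forall t, a <= t <= b -> 0 <= g t) ->
  (forall t, a <= t <= b -> ((g t)%:E <= total_rate alpha t)%E) ->
  p * \int[mu]_(t in `[a, b]) g t <= reservoir p alpha b - reservoir p alpha a.
Proof.
move=> a00 ab b1 gi g0 gA; have a1 : a <= 1 by exact: le_trans b1.
rewrite /reservoir (min_idPr a1) (min_idPr b1) -mulrBr ler_wpM2l ?(ltW p0)//.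
rewrite lerBrDl -lee_fin EFinD !fineK ?mass_fin//; last exact: integrable_fin_num gi.
have sub : `]a, b] `<=` (`[a, b] : set R) by apply: subset_itv; rewrite bnd_simp.
have gi' : mu.-integrable `]a, b] (EFin \o g) by apply: (@integrableS _ _ _ mu `[a, b]).
have mg : measurable_fun `]a, b] (EFin \o g) by case/integrableP : gi'.
have -> : (\int[mu]_(t in `[a, b]) (g t)%:E = \int[mu]_(t in `]a, b]) (g t)%:E)%E.
  exact/esym/integral_itv_obnd_cbnd.
have -> : clp_mass alpha b =
    (clp_mass alpha a + \int[mu]_(t in `]a, b]) total_rate alpha t)%E.
  rewrite /clp_mass (@itv_bndbnd_setU _ _ _ (BRight a)) ?bnd_simp//.
  apply: ge0_integral_setU => //.
  - rewrite -itv_bndbnd_setU ?bnd_simp//; apply: mA_ab.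
    by apply: subset_itv; rewrite bnd_simp.
  - rewrite -itv_bndbnd_setU ?bnd_simp// => t /=; rewrite in_itv/= => /andP[t0 tb].
    by apply: A0; rewrite t0 (le_trans tb).
  - apply/disj_setPS => t [] /=; rewrite !in_itv/= => /andP[_ ta] /andP[+ _].
    by rewrite ltNge ta.
rewrite leeD2l//; apply: ge0_le_integral => //.
- by move=> t /sub /=; rewrite in_itv/= lee_fin; exact: g0.
- by apply: mA_ab; apply: subset_itv; rewrite bnd_simp.
- by move=> t /sub /=; rewrite in_itv/=; exact: gA.
Qed.

Definition clp_integrand (k : nat) t : R :=
  \sum_(1 <= s < k.+1) alpha t s * rank_weight k t s.

Let integrand_ge0 k t : 0 <= t <= 1 -> 0 <= clp_integrand k t.
Proof.
by move=> t01; apply: sumr_ge0 => s _; rewrite mulr_ge0 ?a0 ?rank_weight_ge0.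
Qed.

Let integrand_le_sum k t : 0 <= t <= 1 ->
  clp_integrand k t <= \sum_(1 <= s < k.+1) alpha t s.
Proof.
move=> t01; apply: ler_sum_nat => s /andP[s1 sk].
by rewrite ler_piMr ?a0// rank_weight_le1// s1.
Qed.

(** The factor t of each weight turns alpha into t alpha(t, s) <= 1 - H(t); what is left of the
    weights sums to k. *)
Let integrand_le_mul k t : 0 <= t <= 1 ->
  clp_integrand k t <= k%:R * (1 - reservoir p alpha t).
Proof.
move=> t01; rewrite -(sum_rank_weight' k t) big_distrl/=.
apply: ler_sum_nat => s /andP[s1 sk].
rewrite rank_weightE// mulrCA mulrA mulrC ler_wpM2l ?rank_weight'_ge0//.
exact: mul_alpha_le.
Qed.

Let reservoir_ge0 t : 0 <= t -> 0 <= reservoir p alpha t.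
Proof. by move=> t0; rewrite -(reservoir0 p alpha) reservoir_nondecreasing. Qed.

Let measurable_integrand k : measurable_fun (`[0, 1] : set R) (clp_integrand k).
Proof.
apply: measurable_sum => s; apply: measurable_funM; first by case: fea.
apply: measurable_sum => l; apply: measurable_funM.
  apply: measurable_funM; first exact: measurable_cst.
  exact: measurable_funX.
by apply: measurable_funX; apply: measurable_funB => //; exact: measurable_cst.
Qed.

Let integrable_integrand k a b : 0 <= a -> b <= 1 ->
  mu.-integrable `[a, b] (EFin \o clp_integrand k).
Proof.
move=> a00 b1; apply: (@itv_integrableS _ _ 0 _ _ 1) => //.
apply: (@bounded_itv_integrable _ _ _ _ 0 k%:R) => // t t01.
rewrite integrand_ge0//=; apply: (le_trans (integrand_le_mul k t01)).
by rewrite ler_piMr// gerBl reservoir_ge0//; case/andP: t01.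
Qed.

Let integrable_empty a b : 0 <= a -> b <= 1 ->
  mu.-integrable `[a, b] (EFin \o (fun t => 1 - reservoir p alpha t)).
Proof.
move=> a00 b1; apply: (@itv_integrableS _ _ 0 _ _ 1) => //.
apply: (@bounded_itv_integrable _ _ _ _ 0 1) => //.
  apply: measurable_funB; first exact: measurable_cst.
  by apply: nondecreasing_measurable => //; exact: reservoir_nondecreasing.
move=> t /andP[t0 t1]; rewrite gerBl reservoir_ge0// subr_ge0 andbT.
by apply: le_trans reservoir_le1; exact: reservoir_nondecreasing.
Qed.

Let clp_valueE k :
  clp_value alpha k = (\int[mu]_(t in `[0%R, 1%R]) clp_integrand k t)%:E.
Proof.
rewrite /Rintegral fineK//.
by apply: integrable_fin_num => //; exact: integrable_integrand.
Qed.

Lemma clp_value_le k T : p < 1 -> 0 <= T <= 1 ->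
  gamma * (1 - (1 - p) ^+ k) <=
  reservoir p alpha T + p * (\int[mu]_(t in `[T, 1]) (1 - reservoir p alpha t)) * k%:R.
Proof.
(* The program constrains only k >= 1, but the Poisson law charges 0 as well; there the claim reads
   0 <= H(T). *)
move=> p1 /andP[T0 T1]; case: k => [|k].
  by rewrite subrr !mulr0 addr0 reservoir_ge0.
have q0 : 0 < 1 - (1 - p) ^+ k.+1.
  by rewrite subr_gt0 exprn_ilt1// ?subr_ge0 ?(ltW p1)// gtrBl.
have : (gamma%:E <= (p / (1 - (1 - p) ^+ k.+1))%:E * clp_value alpha k.+1)%E.
  by case: fea => _ _ _ _; apply.
rewrite clp_valueE -EFinM lee_fin mulrAC ler_pdivlMr// => /le_trans; apply.
rewrite (@Rintegral_itv_split _ _ 0 T 1) ?integrable_integrand// mulrDr lerD//.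
  have := @le_reservoirB (clp_integrand k.+1) 0 T; rewrite reservoir0 subr0.
  apply => //.
  - exact: integrable_integrand.
  - by move=> t /andP[t0 tT]; rewrite integrand_ge0// t0 (le_trans tT).
  - move=> t /andP[t0 tT]; have t01 : 0 <= t <= 1 by rewrite t0 (le_trans tT).
    apply: (@le_trans _ _ (\sum_(1 <= s < k.+2) alpha t s)%:E).
      by rewrite lee_fin integrand_le_sum.
    by apply: sum_le_total_rate => s; exact: a0.
rewrite -mulrA ler_wpM2l ?(ltW p0)// mulrC -RintegralZl//; last exact: integrable_empty.
apply: le_Rintegral => //.
- exact: integrable_integrand.
- exact: (integrableZl _ k.+1%:R (integrable_empty T0 (lexx 1))).
- move=> t /=; rewrite in_itv/= => /andP[Tt t1].
  by apply: integrand_le_mul; rewrite t1 (le_trans T0).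
Qed.

Lemma gamma_le_1Bbeta (beta : R) : p < 1 -> 1 < beta -> beta_eq beta -> gamma <= 1 / beta.
Proof.
move=> p1 b1 be; have g0 : 0 <= gamma by case: fea.
apply: (prophet_bound b1 be g0 reservoir_nondecreasing (reservoir0 _ _) reservoir_le1).
  (* The case k = 1, T = 0, divided by p, is the required lower bound on the integral of 1 - H. *)
  have := @clp_value_le 1 0 p1; rewrite lexx ler01 reservoir0 expr1 subKr add0r mulr1.
  by rewrite mulrC ler_pM2l// => /(_ isT).
move=> y T /andP[y0 y1] T01.
(* The Poisson parameter x = - ln y / p makes exp (- x p) equal to y. *)
have l0 : 0 <= - ln y / p by rewrite divr_ge0 ?(ltW p0)// oppr_ge0 ln_le0.
have := poisson_average l0 (fun k => clp_value_le k p1 T01).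
rewrite subKr divfK ?gt_eqF// opprK lnK ?posrE//.
set B := Rintegral _ _ _.
by have -> : p * B * (- ln y / p) = - (ln y * B) by field; rewrite gt_eqF.
Qed.

Lemma gamma_le_powR : p < 1 -> gamma <= p `^ (p / (1 - p)).
Proof.
move=> p1; apply: (@best_only_bound _ p gamma (reservoir p alpha) (alpha^~ 1%N)).
- by rewrite p0.
- by case: fea.
- by case: fea => _ _ + _ _ => + t t01; apply.
- by rewrite reservoir0.
- by move=> t t01; exact: mul_alpha_le.
- move=> a b a00 ab b1; apply: le_reservoirB => //.
  + apply: (@itv_integrableS _ _ 0 _ _ 1) => //.
    apply: (@bounded_itv_integrable _ _ _ _ 0 1) => //; first by case: fea.
    by case: fea => _ _ + _ _ => + t t01; apply.
  + by move=> t /andP[at_ tb]; rewrite a0// (le_trans a00)//= (le_trans tb).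
  + move=> t /andP[at_ tb]; have := @sum_le_total_rate alpha t 2.
    by rewrite big_nat1; apply => s; rewrite a0// (le_trans a00)//= (le_trans tb).
- have : (gamma%:E <= (p / (1 - (1 - p) ^+ 1))%:E * clp_value alpha 1)%E.
    by case: fea => _ _ _ _; apply.
  rewrite expr1 subKr divff ?gt_eqF// mul1e.
  rewrite clp_valueE lee_fin => /le_trans; apply.
  rewrite le_eqVlt; apply/orP; left; apply/eqP; apply: eq_Rintegral => t _.
  by rewrite /clp_integrand /rank_weight !big_nat1 bin0 subnn expr0 expr1 mulr1 mul1r mulrC.
Qed.

End feasible.
End reservoir.

Theorem theorem3 (R : realType) :
  (exists! beta : R, 1 < beta /\ beta_eq beta) /\
  (forall beta : R, 1 < beta -> beta_eq beta ->
   forall p : R, 0 < p < 1 ->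
     (gamma_infty_star p <= (Num.min (p `^ (p / (1 - p))) (1 / beta))%:E)%E).
Proof.
split; first exact: beta_eq_exists_unique.
move=> beta b1 be p /andP[p0 p1]; apply: ge_ereal_sup => _ [gamma [alpha fea] <-].
rewrite lee_fin le_min; apply/andP; split.
  exact: (gamma_le_powR p0 fea).
exact: (gamma_le_1Bbeta p0 fea).
Qed.
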